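(* Let $p$ be a prime, $q$ a power of $p$, and $\mathbb{F}_q$ the field with $q$ elements. Fix any bijection $\varphi:\mathbb{F}_q\to\{0,1,\dots,q-1\}$ with $\varphi(0)=0$, and for a matrix $K$ over $\mathbb{F}_q$ let $s(K)=\varphi(\sigma(K))$, where $\sigma(K)\in\mathbb{F}_q$ is the sum of all entries of $K$ computed in $\mathbb{F}_q$. Let $\omega_q$ be a primitive complex $q$-th root of unity. Then for every $n\ge 1$, $$\sum_{K\in GL_n(\mathbb{F}_q)}\omega_q^{s(K)}=-(q-1)^{n-1}q^{\binom n2}[n-1]_q!.$$
   Context: For an integer $m\ge1$, $[m]_q=1+q+\cdots+q^{m-1}=\frac{1-q^m}{1-q}$, and $[m]_q!=[m]_q[m-1]_q\cdots[1]_q$, with $[0]_q!=1$. *)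

(* Defs.v *)
From HB Require Import structures.
From mathcomp Require Import all_boot all_order all_algebra.

Set Implicit Arguments.
Unset Strict Implicit.
Unset Printing Implicit Defensive.

Import GRing.Theory.
Local Open Scope ring_scope.

Definition qint (R : nzRingType) (x : R) (m : nat) : R := \sum_(i < m) x ^+ i.

Definition qfact (R : nzRingType) (x : R) (m : nat) : R :=
  \prod_(1 <= i < m.+1) qint x i.

Definition entry_sum (V : nmodType) (m n : nat) (K : 'M[V]_(m, n)) : V :=
  \sum_i \sum_j K i j.

Definition entry_sum_index (V : nmodType) (q : nat) (phi : V -> 'I_q)
  (m n : nat) (K : 'M[V]_(m, n)) : nat := phi (entry_sum K).

(* Main.v *)
(** The entry sum of [K] is [1 K 1^T], a function of the row vector [1 K] alone.
    As [GL_n] is transitive on nonzero vectors, [1 K] is equidistributed over them,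
    so the sum equals [|GL_n| / (q^n - 1)] times the sum of [omega ^ phi (sum v)]
    over nonzero [v]. Over all [v] the latter sum vanishes, so without the term
    [v = 0] it is [-1]. *)

Require Import Defs.
From HB Require Import structures.
From mathcomp Require Import all_boot all_order all_algebra reals complex.

Set Implicit Arguments.
Unset Strict Implicit.
Unset Printing Implicit Defensive.

Import Order.TTheory GRing.Theory Num.Theory.
Local Open Scope ring_scope.

Lemma entry_sumM (F : pzSemiRingType) (m n : nat) (K : 'M[F]_(m, n)) :
  entry_sum K = entry_sum (const_mx 1 *m K : 'rV_n).
Proof.
rewrite /entry_sum big_ord1 exchange_big /=; apply: eq_bigr => j _.
by rewrite mxE; apply: eq_bigr => i _; rewrite mxE mul1r.
Qed.

(** A rank-one matrix already sends [u] to [v]. Since [u] and [v] both have rank 1,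
    [complete_unitmx] replaces it by an invertible matrix with the same value at [u]. *)
Lemma unitmx_transitive (F : fieldType) (n : nat) (u v : 'rV[F]_n) :
  u != 0 -> v != 0 -> exists2 H, H \in unitmx & u *m H = v.
Proof.
move=> u0 v0; have [i ui0] : exists i, u 0 i != 0.
  apply/existsP; rewrite -[[exists _, _]]negbK negb_exists; apply: contra u0.
  move=> /forallP u0; apply/eqP/rowP => i.
  by rewrite mxE; apply/eqP; rewrite -[_ == _]negbK.
(* The only nonzero row of [f] is row [i], equal to [v / u_i]. *)
pose f := (u 0 i)^-1 *: (delta_mx i 0 *m v) : 'M[F]_n.
have uf : u *m f = v.
  rewrite -scalemxAr mulmxA -colE [col i u]mx11_scalar mxE mul_scalar_mx scalerA.
  by rewrite mulVf // scale1r.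
have [|H Hu uH] := @complete_unitmx F 1 n u f; first by rewrite uf !rank_rV u0 v0.
by exists H; rewrite // -uH.
Qed.

(** Double counting of the sum of [g (v K)] over all pairs of a nonzero [v] and an invertible [K].
    The inner sum over [K] does not depend on [v]: if [v = w H], left translation by [H] permutes
    the group. The inner sum over [v] does not depend on [K], which permutes the nonzero vectors. *)
Lemma sum_GL_mulmx (F : finFieldType) (R : comPzSemiRingType) (n : nat)
    (g : 'rV[F]_n.+1 -> R) (w : 'rV[F]_n.+1) :
  w != 0 ->
  (#|F| ^ n.+1 - 1)%N%:R * \sum_(K in 'GL_n.+1[F]%g) g (w *m GLval K) =
  #|'GL_n.+1[F]%g|%:R * \sum_(v | v != 0) g v.
Proof.
move=> w0.
have sum_orbit (v : 'rV[F]_n.+1) : v != 0 ->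
    \sum_(K in 'GL_n.+1[F]%g) g (v *m GLval K) =
    \sum_(K in 'GL_n.+1[F]%g) g (w *m GLval K).
  move=> v0; have [H Hu <-] := unitmx_transitive w0 v0.
  rewrite [RHS](reindex_inj (mulgI (FinRing.unit _ Hu))) /=.
  by apply: eq_big => [K|K _]; rewrite ?inE // mulmxA.
have sum_unit (K : {'GL_n.+1[F]}) :
    \sum_(v | v != 0) g (v *m GLval K) = \sum_(v | v != 0) g v.
  have Ku : GLval K \in unitmx by exact: (valP K).
  have Kinj : injective (mulmxr (GLval K) : 'rV[F]_n.+1 -> _).
    by apply: can_inj (mulmxK Ku).
  rewrite [RHS](reindex_inj Kinj) /=; apply: eq_bigl => v.
  by rewrite -(inj_eq Kinj) /= mul0mx.
have card_neq0 : #|[pred v : 'rV[F]_n.+1 | v != 0]| = (#|F| ^ n.+1 - 1)%N.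
  rewrite subn1 -[n.+1 in RHS]mul1n -card_mx -(cardC1 (0 : 'rV[F]_n.+1)).
  exact: eq_card.
rewrite -card_neq0 mulr_natl -sumr_const -(eq_bigr _ sum_orbit) exchange_big /=.
by rewrite (eq_bigr _ (fun K _ => sum_unit K)) sumr_const mulr_natl.
Qed.

(** Adding [a] to the first coordinate permutes the vectors and shifts the entry sum by [a]. Summed
    over all [a], this gives [#|F|] copies of the sum on one side and full sums of [h], hence 0, on
    the other; characteristic 0 allows cancelling [#|F|]. *)
Lemma sum_entry_sum_eq0 (F : finFieldType) (R : numDomainType) (n : nat)
    (h : F -> R) :
  \sum_a h a = 0 -> \sum_(v : 'rV[F]_n.+1) h (entry_sum v) = 0.
Proof.
move=> h0; set S := LHS.
have shift a : \sum_(v : 'rV[F]_n.+1) h (entry_sum v + a) = S.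
  rewrite [RHS](reindex_inj (addIr (a *: delta_mx 0 0))) /=.
  apply: eq_bigr => v _; congr h; rewrite /entry_sum !big_ord1.
  under [RHS]eq_bigr => j _ do rewrite !mxE.
  rewrite big_split /=; congr (_ + _); rewrite big_ord_recl big1 ?addr0 ?mulr1 //.
  by move=> j _; rewrite mulr0.
have : S *+ #|F| = 0.
  rewrite -sumr_const -(eq_bigr _ (fun a _ => shift a)) exchange_big.
  apply: big1 => v _.
  by rewrite -[RHS]h0 [RHS](reindex_inj (addrI (entry_sum v))); apply: eq_bigl.
by move/eqP; rewrite mulrn_eq0 -[_ == 0%N]negbK -lt0n (cardD1 0) => /eqP.
Qed.

Lemma sum_prim_root (R : idomainType) (q : nat) (z : R) :
  (1 < q)%N -> q.-primitive_root z -> \sum_(i < q) z ^+ i = 0.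
Proof.
move=> q1 zq; have := subrX1 z q; rewrite (prim_expr_order zq) subrr => /esym/eqP.
rewrite mulf_eq0 subr_eq0 => /orP[/eqP z1|/eqP //].
by have := prim_order_dvd zq 1; rewrite z1 expr1n eqxx dvdn1 gtn_eqF.
Qed.

Lemma prod_exprB1 (R : comNzRingType) (x : R) (n : nat) :
  \prod_(1 <= i < n.+1) (x ^+ i - 1) = (x - 1) ^+ n * qfact x n.
Proof.
under eq_bigr => i _ do rewrite subrX1.
by rewrite big_split prodr_const_nat subn1.
Qed.

Theorem theorem3p1 (p k q : nat) (F : finFieldType) (phi : F -> 'I_q)
    (R : realType) (omega : R[i]) (n : nat) :
  prime p -> (0 < k)%N -> q = (p ^ k)%N -> #|F| = q ->
  bijective phi -> phi 0 = 0%N :> nat ->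
  q.-primitive_root omega ->
  (1 <= n)%N ->
  \sum_(K in 'GL_n[F]%g) omega ^+ entry_sum_index phi (GLval K) =
  - ((q%:R - 1) ^+ (n - 1) * q%:R ^+ 'C(n, 2) * qfact q%:R (n - 1)).
Proof.
move=> _ _ _ cardF phi_bij phi0 omega_prim.
case: n => // n _; rewrite subn1 /=.
have q1 : (1 < q)%N by rewrite -cardF (card_finNzRing_gt1 F).
have w0 : const_mx 1 != 0 :> 'rV[F]_n.+1.
  by apply/eqP => /rowP/(_ 0)/eqP; rewrite !mxE oner_eq0.
(* [h] need not be an additive character: it takes each power of [omega] once, so its sum over [F]
   vanishes. *)
pose h (a : F) : R[i] := omega ^+ phi a.
have sum_h : \sum_a h a = 0.
  rewrite -[RHS](sum_prim_root q1 omega_prim) [RHS](reindex phi) //.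
  exact: onW_bij.
have sum_neq0 : \sum_(v : 'rV[F]_n.+1 | v != 0) h (entry_sum v) = -1.
  have /eqP := sum_entry_sum_eq0 n sum_h.
  rewrite (bigD1 0) //= addrC addr_eq0 => /eqP ->; congr (- _).
  rewrite /entry_sum big_ord1 big1 => [|j _]; last by rewrite mxE.
  by rewrite /h phi0.
have := sum_GL_mulmx (fun v => h (entry_sum v)) w0.
rewrite /= sum_neq0 card_GL // cardF.
under eq_bigr => K _ do rewrite -entry_sumM.
(* The last factor of the order of the group is [q ^ n.+1 - 1], the number of nonzero vectors. It
   cancels, and the remaining product stops at [n], whence [qfact] at [n]. *)
rewrite big_nat_recr //= mulnA mulnC natrM -mulrA.
have qn0 : (q ^ n.+1 - 1)%N%:R != 0 :> R[i].
  by rewrite pnatr_eq0 -lt0n subn_gt0 -{1}(exp1n n.+1) ltn_exp2r.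
move/(mulfI qn0) => ->; rewrite mulrN1; congr (- _).
rewrite mulrAC -prod_exprB1 mulrC natrM natrX natr_prod; congr (_ * _).
by apply: eq_big_nat => i _; rewrite natrB ?expn_gt0 ?(ltnW q1) // natrX.
Qed.
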